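(* Let $\rho\subset\mathbb{Z}_+^d$ be the shape of some $d$-dimensional partition. Then, as formal power series in $t,q$, $$\sum_{\pi \in \mathcal{P}^{(d)},\ \mathrm{sh}(\pi) \subseteq \rho} t^{\mathrm{cor}(\pi)} q^{|\pi|_{ch}} = \prod_{(i_1,\ldots,i_d) \in \rho} \left( 1 - t q^{i_1 + \cdots + i_d - d + 1} \right)^{-1},$$ $$\sum_{\pi \in \mathcal{P}^{(d)},\ \mathrm{sh}(\pi) = \rho} t^{\mathrm{cor}(\pi)} q^{|\pi|_{ch}} = t^{\mathrm{cr}(\rho)} q^{|\rho|_{cr}} \prod_{(i_1,\ldots,i_d) \in \rho} \left( 1 - t q^{i_1 + \cdots + i_d - d + 1} \right)^{-1}.$$
   Context: $\mathbf{e}_\ell$ denote standard basis vectors. A $d$-dimensional partition is an array $\pi=(\pi_{i_1,\ldots,i_d})_{i_1,\ldots,i_d\ge 1}$ of nonnegative integers with finitely many nonzero entries, weakly decreasing in each coordinate ($\pi_{\mathbf{i}}\ge\pi_{\mathbf{j}}$ when $\mathbf{i}\le\mathbf{j}$ componentwise); $\mathcal{P}^{(d)}$ is their set. Its diagram is $D(\pi)=\{(i_1,\ldots,i_d,i)\in\mathbb{Z}_+^{d+1}: 1\le i\le\pi_{i_1,\ldots,i_d}\}$ and its shape is $\mathrm{sh}(\pi)=\{\mathbf{i}\in\mathbb{Z}_+^d:\pi_{\mathbf{i}}>0\}$. A shape of a $d$-dimensional partition is thus a finite subset $\rho\subset\mathbb{Z}_+^d$ closed downward under the componentwise order. Corners: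 $\mathrm{Cor}(\pi)=\{\mathbf{i}\in D(\pi):\mathbf{i}+\mathbf{e}_\ell\notin D(\pi)\ \forall \ell\in[d]\}$, $\mathrm{cor}(\pi)=|\mathrm{Cor}(\pi)|$. For $\mathbf{i}=(i_1,\ldots,i_d)$, $\mathrm{ch}(\mathbf{i})=i_1+\cdots+i_d-d+1$, and $|\pi|_{ch}=\sum_{(\mathbf{i},i_{d+1})\in\mathrm{Cor}(\pi)}\mathrm{ch}(\mathbf{i})$. For a shape $\rho$, its top corners are $\mathrm{Cr}(\rho)=\{\mathbf{i}\in\rho:\mathbf{i}+\mathbf{e}_\ell\notin\rho\ \forall\ell\in[d]\}$, $\mathrm{cr}(\rho)=|\mathrm{Cr}(\rho)|$ and $|\rho|_{cr}=\sum_{\mathbf{i}\in\mathrm{Cr}(\rho)}\mathrm{ch}(\mathbf{i})$. *)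

(* Defs.v *)
From HB Require Import structures.
From mathcomp Require Import all_boot all_order all_algebra.
From mathcomp Require Import finmap.
From mathcomp Require Import mathcomp_extra boolp classical_sets functions.
From mathcomp Require Import cardinality fsbigop.

Set Implicit Arguments.
Unset Strict Implicit.
Unset Printing Implicit Defensive.

Import Order.TTheory GRing.Theory Num.Theory.

Local Open Scope classical_set_scope.
Local Open Scope ring_scope.

Record fps (R : Type) := Fps { fpscoef : nat -> R }.

Section FpsRing.
Variable R : comNzRingType.
Implicit Types f g h : fps R.

HB.instance Definition _ := gen_eqMixin (fps R).
HB.instance Definition _ := gen_choiceMixin (fps R).

Lemma fpsP f g : fpscoef f =1 fpscoef g <-> f = g.
Proof. by split=> [|->//]; case: f g => [f] [g] /funext /= ->. Qed.

Definition fps_zero : fps R := Fps (fun=> 0).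
Definition fps_opp f : fps R := Fps (fun n => - fpscoef f n).
Definition fps_add f g : fps R := Fps (fun n => fpscoef f n + fpscoef g n).

Fact fps_addA : associative fps_add.
Proof. by move=> f g h; apply/fpsP => n /=; rewrite addrA. Qed.
Fact fps_addC : commutative fps_add.
Proof. by move=> f g; apply/fpsP => n /=; rewrite addrC. Qed.
Fact fps_add0 : left_id fps_zero fps_add.
Proof. by move=> f; apply/fpsP => n /=; rewrite add0r. Qed.
Fact fps_addN : left_inverse fps_zero fps_opp fps_add.
Proof. by move=> f; apply/fpsP => n /=; rewrite addNr. Qed.

HB.instance Definition _ :=
  GRing.isZmodule.Build (fps R) fps_addA fps_addC fps_add0 fps_addN.

Definition fpsC (c : R) : fps R := Fps (fun n => if n == 0%N then c else 0).
Definition fps_mul f g : fps R :=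
  Fps (fun n => \sum_(i < n.+1) fpscoef f i * fpscoef g (n - i)).

Fact fps_mulC : commutative fps_mul.
Proof.
move=> f g; apply/fpsP => n /=; rewrite (reindex_inj rev_ord_inj) /=.
by apply: eq_bigr => i _; rewrite mulrC subSS subKn // leq_ord.
Qed.

Fact fps_mulA : associative fps_mul.
Proof.
move=> p q r; rewrite [in RHS]fps_mulC [fps_mul q r]fps_mulC.
apply/fpsP=> i /=.
pose coef3 j k := fpscoef p j * (fpscoef r k * fpscoef q (i - j - k)%N).
transitivity (\sum_(j < i.+1) \sum_(k < i.+1 | (k <= i - j)%N) coef3 j k).
  apply: eq_bigr => /= j _; rewrite big_distrr /=.
  by rewrite (big_ord_narrow_leq (leq_subr _ _)).
rewrite (exchange_big_dep predT) //=; apply: eq_bigr => k _.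
transitivity (\sum_(j < i.+1 | (j <= i - k)%N) coef3 j k).
  apply: eq_bigl => j; rewrite -ltnS -(ltnS j) -!subSn ?leq_ord //.
  by rewrite -subn_gt0 -(subn_gt0 j) -!subnDA addnC.
rewrite (big_ord_narrow_leq (leq_subr _ _)) big_distrr /=.
by apply: eq_bigr => j _; rewrite /coef3 -!subnDA addnC mulrCA.
Qed.

Fact fps_mul1 : left_id (fpsC 1) fps_mul.
Proof.
move=> f; apply/fpsP => n /=; rewrite big_ord_recl /= mul1r subn0.
by rewrite big1 ?addr0 // => i _; rewrite mul0r.
Qed.

Fact fps_mulDl : left_distributive fps_mul fps_add.
Proof.
move=> f g h; apply/fpsP => n /=; rewrite -big_split /=.
by apply: eq_bigr => i _; rewrite mulrDl.
Qed.

Fact fps_1neq0 : fpsC 1 != fps_zero.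
Proof.
by apply/eqP => /(congr1 (fun f => fpscoef f 0)) /= /eqP; rewrite oner_eq0.
Qed.

HB.instance Definition _ := GRing.Zmodule_isComNzRing.Build (fps R)
  fps_mulA fps_mulC fps_mul1 fps_mulDl fps_1neq0.

Definition fpsX : fps R := Fps (fun n => (n == 1%N)%:R).

Lemma fpscoef0 n : fpscoef (0 : fps R) n = 0. Proof. by []. Qed.
Lemma fpscoef1 n : fpscoef (1 : fps R) n = (n == 0%N)%:R.
Proof. by case: n. Qed.
Lemma fpscoefD f g n : fpscoef (f + g) n = fpscoef f n + fpscoef g n.
Proof. by []. Qed.
Lemma fpscoefN f n : fpscoef (- f) n = - fpscoef f n.
Proof. by []. Qed.
Lemma fpscoefM f g n :
  fpscoef (f * g) n = \sum_(i < n.+1) fpscoef f i * fpscoef g (n - i).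
Proof. by []. Qed.

Lemma fpscoefMX f n :
  fpscoef (f * fpsX) n = if n is m.+1 then fpscoef f m else 0.
Proof.
rewrite fpscoefM; case: n => [|n]; first by rewrite big_ord1 mulr0.
rewrite big_ord_recr big_ord_recr /= subnn subSnn mulr0 mulr1 addr0.
rewrite big1 ?add0r // => i _; rewrite subSn; last exact: ltnW.
by rewrite eqSS subn_eq0 leqNgt ltn_ord mulr0.
Qed.

Lemma fpscoefXn a n : fpscoef (fpsX ^+ a) n = (n == a)%:R.
Proof.
elim: a n => [|a IHa] n; first by rewrite expr0 fpscoef1.
by rewrite exprSr fpscoefMX; case: n => // n; rewrite IHa.
Qed.

Lemma fpscoefMC f c n : fpscoef (f * fpsC c) n = fpscoef f n * c.
Proof.
rewrite fpscoefM big_ord_recr /= subnn big1 ?add0r // => i _.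
by rewrite subn_eq0 leqNgt ltn_ord mulr0.
Qed.

Lemma fpsCXn c a : fpsC c ^+ a = fpsC (c ^+ a).
Proof.
elim: a => [|a IHa]; first by rewrite !expr0.
rewrite !exprSr IHa; apply/fpsP => n; rewrite fpscoefMC /=.
by case: n => //= n; rewrite mul0r.
Qed.

End FpsRing.

Section FpsUnitRing.
Variable R : comUnitRingType.
Implicit Types f g : fps R.

Definition fps_unit : {pred fps R} :=
  fun f => fpscoef f 0 \is a GRing.unit.

(* The list of the first n coefficients of the inverse of f. *)
Fixpoint fps_invseq f n : seq R :=
  if n is m.+1 then
    let s := fps_invseq f m in
    rcons s ((fpscoef f 0)^-1 *
             ((m == 0%N)%:R - \sum_(i < m) s`_i * fpscoef f (m - i)))
  else [::].

Definition fps_inv f : fps R :=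
  if fps_unit f then Fps (fun n => (fps_invseq f n.+1)`_n) else f.

Lemma size_fps_invseq f n : size (fps_invseq f n) = n.
Proof. by elim: n => //= n IHn; rewrite size_rcons IHn. Qed.

Lemma nth_fps_invseq f n i :
  (i < n)%N -> (fps_invseq f n)`_i = (fps_invseq f i.+1)`_i.
Proof.
elim: n => // n IHn; rewrite ltnS leq_eqVlt => /predU1P[-> //|lt_in].
by rewrite [LHS]/= nth_rcons size_fps_invseq lt_in IHn.
Qed.

Fact fps_mulVx : {in fps_unit, left_inverse 1 fps_inv *%R}.
Proof.
move=> f Uf; have Uf0 : fpscoef f 0 \is a GRing.unit by [].
apply/fpsP => n; rewrite fpscoefM fpscoef1 /fps_inv.
have -> : fps_unit f by [].
rewrite big_ord_recr /= subnn.
rewrite nth_rcons size_fps_invseq ltnn eqxx mulrAC mulVr // mul1r.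
set S := (X in X + _ = _); set S' := (X in _ + (_ - X) = _).
suff -> : S = S' by rewrite addrC subrK.
apply: eq_bigr => i _; congr (_ * _).
by rewrite [RHS](nth_fps_invseq _ (ltn_ord i)).
Qed.

Fact fps_unitPl f g : g * f = 1 -> fps_unit f.
Proof.
move=> /(congr1 (fun h => fpscoef h 0)) /=.
rewrite big_ord1 subn0 => gf1.
by apply/unitrPr; exists (fpscoef g 0); rewrite mulrC.
Qed.

Fact fps_inv_out : {in [predC fps_unit], fps_inv =1 id}.
Proof. by move=> f; rewrite inE /fps_inv => /negPf Uf; rewrite [fps_unit f]Uf. Qed.

HB.instance Definition _ := GRing.ComNzRing_hasMulInverse.Build (fps R)
  fps_mulVx fps_unitPl fps_inv_out.

Lemma fps_unitE f : (f \is a GRing.unit) = (fpscoef f 0 \is a GRing.unit).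
Proof. by []. Qed.

End FpsUnitRing.

(* Z[[t, q]], realised as Z[[q]][[t]]. *)
Definition fps_tq : comUnitRingType := fps (fps int).
Definition ser_t : fps_tq := fpsX (fps int).
Definition ser_q : fps_tq := fpsC (fpsX int).

(* The coefficient of t^m q^n. *)
Definition coef_tq (m n : nat) (F : fps_tq) : int := fpscoef (fpscoef F m) n.

Lemma coef_tq_monom m n a b :
  coef_tq m n (ser_t ^+ a * ser_q ^+ b) = ((m == a) && (n == b))%:R.
Proof.
rewrite /coef_tq /ser_q fpsCXn fpscoefMC fpscoefXn.
by case: (m == a); rewrite ?mul1r ?mul0r //= fpscoefXn.
Qed.

Lemma unit_1subtq k : (1 - ser_t * ser_q ^+ k) \is a GRing.unit.
Proof.
rewrite fps_unitE fpscoefD fpscoefN fpscoefM big_ord1 /= mul0r subr0.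
exact: unitr1.
Qed.

(* The family (F x) for x in A is summable in Z[[t, q]], with sum S. *)
Definition has_sum_tq (T : choiceType) (A : set T) (F : T -> fps_tq)
    (S : fps_tq) : Prop :=
  forall m n : nat,
    finite_set [set x | A x /\ coef_tq m n (F x) != 0] /\
    \sum_(x \in A) coef_tq m n (F x) = coef_tq m n S.

Section Partitions.
Variable d : nat.
Implicit Types (i j : 'rV[nat]_d) (rho : set 'rV[nat]_d).

Definition posvec : set 'rV[nat]_d :=
  [set i : 'rV[nat]_d | forall l, (0 < i ord0 l)%N].

Definition vle i j : Prop := forall l, (i ord0 l <= j ord0 l)%N.

(* An array indexed by Z_+^d is encoded by its extension by 0 to N^d. *)
Definition dpartition : set ('rV[nat]_d -> nat) :=
  [set pi : 'rV[nat]_d -> nat |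
    [/\ forall i, ~ posvec i -> pi i = 0%N,
        finite_set [set i | pi i <> 0%N] &
        forall i j, posvec i -> posvec j -> vle i j -> (pi j <= pi i)%N]].

Implicit Type pi : 'rV[nat]_d -> nat.

(* (i, k) stands for the point (i_1, ..., i_d, k) of Z_+^(d+1). *)
Definition diagram pi : set ('rV[nat]_d * nat) :=
  [set x : 'rV[nat]_d * nat | posvec x.1 /\ (1 <= x.2 <= pi x.1)%N].

Definition pshape pi : set 'rV[nat]_d :=
  [set i : 'rV[nat]_d | posvec i /\ (0 < pi i)%N].

(* Only the first d basis vectors of Z^(d+1) occur: the last coordinate is
   fixed. *)
Definition Cor pi : set ('rV[nat]_d * nat) :=
  [set x : 'rV[nat]_d * nat | diagram pi x /\
    forall l : 'I_d, ~ diagram pi (x.1 + delta_mx ord0 l, x.2)].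

Definition cor pi : nat := #|` fset_set (Cor pi)|.

(* On Z_+^d the subtraction is not truncated. *)
Definition ch i : nat := (\sum_(l < d) i ord0 l - d + 1)%N.

Definition ch_weight pi : nat := \sum_(x \in Cor pi) ch x.1.

Definition Cr rho : set 'rV[nat]_d :=
  [set i : 'rV[nat]_d | rho i /\ forall l : 'I_d, ~ rho (i + delta_mx ord0 l)].

Definition cr rho : nat := #|` fset_set (Cr rho)|.

Definition cr_weight rho : nat := \sum_(i \in Cr rho) ch i.

Lemma finite_shape pi : dpartition pi -> finite_set (pshape pi).
Proof.
case=> _ fin_pi _; apply: sub_finite_set fin_pi => i [_ pi_gt0] /= pi0.
by rewrite pi0 in pi_gt0.
Qed.

Lemma finite_diagram pi : dpartition pi -> finite_set (diagram pi).
Proof.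
move=> part_pi; have fin_sh := finite_shape part_pi.
suff -> : diagram pi = \bigcup_(i in pshape pi)
    (fun k => (i, k.+1)) @` `I_(pi i).
  by apply: bigcup_finite => // i _; exact/finite_image/finite_II.
apply/seteqP; split=> [[i k] [/= pos_i]|_ [i [pos_i _]] [k /= ltk <-]].
  case: k => // k /= ltk; exists i; last by exists k.
  by split=> //; apply: leq_ltn_trans ltk.
by split.
Qed.

Lemma finite_Cor pi : dpartition pi -> finite_set (Cor pi).
Proof. by move/finite_diagram; apply: sub_finite_set => x []. Qed.

Lemma finite_Cr rho : finite_set rho -> finite_set (Cr rho).
Proof. by apply: sub_finite_set => i []. Qed.

End Partitions.

(* Main.v *)
Require Import Defs.
From HB Require Import structures.
From mathcomp Require Import all_boot all_order all_algebra.
From mathcomp Require Import finmap.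
From mathcomp Require Import mathcomp_extra boolp classical_sets functions.
From mathcomp Require Import cardinality fsbigop.

Set Implicit Arguments.
Unset Strict Implicit.
Unset Printing Implicit Defensive.

Import GRing.Theory.

Local Open Scope classical_set_scope.
Local Open Scope ring_scope.

(** The corners of [pi] above the point [i] are the [(i, k)] with
    [max_l pi (i + e_l) < k <= pi i], so there are
    [m i = pi i - max_l pi (i + e_l)] of them (the [excess] of [pi] at [i]), and
    [cor pi] and [|pi|_ch] are the sums of [m i] and [m i * ch i]. Conversely
    [pi i = m i + max_l pi (i + e_l)] recovers [pi] from an arbitrary [m]
    supported on [rho] (directed last passage percolation). Hence the sum over
    [sh pi] contained in [rho] is a product of geometric series. Since [rho] is
    closed downward, [sh pi = rho] says that [m] is positive on the top corners
    of [rho], which shifts the corresponding series by one step. *)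

(** * Summable families and products of geometric series *)

Lemma has_sum_tq_bij (T U : choiceType) (A : set T) (B : set U) (h : T -> U)
    (F : T -> fps_tq) (G : U -> fps_tq) (S : fps_tq) :
    set_bij A B h -> (forall x, A x -> G (h x) = F x) ->
  has_sum_tq A F S -> has_sum_tq B G S.
Proof.
move=> bij_h GhE sumF m n; have [finF <-] := sumF m n; split.
  apply: sub_finite_set (finite_image h finF) => y [By Gy_neq0].
  have [x Ax xy] := set_bij_surj bij_h By.
  by exists x => //; split=> //; rewrite -GhE // xy.
rewrite (reindex_fsbig h A B) //; apply: eq_fsbigr => x /set_mem Ax.
by rewrite GhE.
Qed.

Lemma fsbig_finType (R : Type) (idx : R) (op : Monoid.com_law idx)
    (T : finType) (P : pred T) (F : T -> R) :
  \big[op/idx]_(x \in [set x | P x]) F x = \big[op/idx]_(x | P x) F x.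
Proof.
rewrite -[RHS]big_filter.
rewrite [RHS]fsbig_seq ?filter_uniq ?index_enum_uniq //.
apply: eq_fsbigl; apply/seteqP.
by split=> x /=; rewrite mem_filter mem_index_enum andbT.
Qed.

(* Congruence modulo t^(N+1). *)
Definition eqmod_t (N : nat) (F G : fps_tq) : Prop :=
  forall i, (i <= N)%N -> fpscoef F i = fpscoef G i.

Lemma eqmod_tM N F F' G G' :
  eqmod_t N F G -> eqmod_t N F' G' -> eqmod_t N (F * F') (G * G').
Proof.
move=> eqFG eqFG' i leiN; rewrite !fpscoefM; apply: eq_bigr => j _.
rewrite eqFG ?eqFG' //; first exact: leq_trans (leq_subr _ _) leiN.
by apply: leq_trans leiN; rewrite -ltnS.
Qed.

Lemma eqmod_t_prod N (I : finType) (F G : I -> fps_tq) :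
  (forall i, eqmod_t N (F i) (G i)) -> eqmod_t N (\prod_i F i) (\prod_i G i).
Proof. by move=> eqFG; elim/big_rec2: _ => // i y z _; apply: eqmod_tM. Qed.

(** Multiplied by [1 - u], the truncated series telescopes to [u ^+ a - u ^+ N.+1], and [u ^+ N.+1]
    is divisible by [t^(N+1)]. The case [a = N.+1] is the empty sum. *)
Lemma geometric_eqmod_t a N k : (a <= N.+1)%N ->
  eqmod_t N (\sum_(j < N.+1 | (a <= j)%N) (ser_t * ser_q ^+ k) ^+ j)
            ((ser_t * ser_q ^+ k) ^+ a / (1 - ser_t * ser_q ^+ k)).
Proof.
move=> leaN; set u := ser_t * ser_q ^+ k.
have Uu : 1 - u \is a GRing.unit by exact: unit_1subtq.
have -> : \sum_(j < N.+1 | (a <= j)%N) u ^+ j = (u ^+ a - u ^+ N.+1) / (1 - u).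
  apply: (canRL (mulrK Uu)); rewrite mulr_suml.
  transitivity (\sum_(a <= j < N.+1) (u ^+ j * (1 - u))).
    by rewrite big_geq_mkord.
  rewrite -[RHS]opprB -telescope_sumr // -sumrN; apply: eq_bigr => j _.
  by rewrite mulrBr mulr1 -exprSr opprB.
apply: eqmod_tM => // i leiN; rewrite fpscoefD fpscoefN.
suff -> : fpscoef (u ^+ N.+1) i = 0 by rewrite subr0.
rewrite /u exprMn -exprM /ser_q fpsCXn fpscoefMC fpscoefXn.
by rewrite ltn_eqF ?ltnS // mul0r.
Qed.

(** Only functions with sum [m] contribute to [t^m], so each geometric series can be cut off at a
    finite degree; distributing the product of finite sums then gives the sum over functions. *)
Lemma has_sum_tq_geometric (I : finType) (w a : I -> nat) :
  has_sum_tq [set f : {ffun I -> nat} | forall i, (a i <= f i)%N]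
    (fun f => ser_t ^+ (\sum_i f i) * ser_q ^+ (\sum_i f i * w i))
    (\prod_i ((ser_t * ser_q ^+ w i) ^+ a i / (1 - ser_t * ser_q ^+ w i))).
Proof.
set A := (X in has_sum_tq X); set F := (X in has_sum_tq A X); move=> m n.
(* The summand [m] bounds every value of a contributing [f]; the other summand ensures that no
   truncation stops short of its lower bound [a i]. *)
pose K := (m + \sum_i a i)%N.
have leaK i : (a i <= K.+1)%N.
  by rewrite (bigD1 i) //= in K *; rewrite /K addnCA leqW ?leq_addr.
pose h (f : {ffun I -> 'I_K.+1}) : {ffun I -> nat} := [ffun i => f i : nat].
have inj_h : injective h.
  move=> f g /ffunP eqfg; apply/ffunP => i; apply: val_inj.
  by have := eqfg i; rewrite !ffunE.
pose E := [pred f : {ffun I -> 'I_K.+1} | [forall i, (a i <= f i)%N]].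
have hE : h @` [set f | E f] `<=` A.
  by move=> _ [f /forallP/= Ef <-] i; rewrite ffunE.
have suppF f : A f -> coef_tq m n (F f) != 0 -> (h @` [set f | E f]) f.
  move=> Af; rewrite coef_tq_monom; case: (m =P _) => // mE _.
  have lefK i : (f i < K.+1)%N.
    rewrite ltnS; apply: leq_trans (leq_addr _ _).
    by rewrite mE (bigD1 i) //= leq_addr.
  exists [ffun i => Ordinal (lefK i)]; last by apply/ffunP=> i; rewrite !ffunE.
  by apply/forallP => i; rewrite ffunE; apply: Af.
split.
  apply: (@sub_finite_set _ _ (h @` [set f | E f])).
    by move=> f [Af]; apply: suppF.
  exact/finite_image/finite_finset.
rewrite -(@fsbig_widen _ _ _ _ (h @` [set f | E f])) //; last first.
  move=> f [Af /= notEf]; apply/eqP; apply/negP => /negP.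
  by move/(suppF _ Af).
rewrite fsbig_image; last by move=> f g _ _; apply: inj_h.
rewrite fsbig_finType.
transitivity (coef_tq m n (\sum_(f | E f) F (h f))).
  rewrite /coef_tq; elim/big_rec2: _ => // f y x _ ->.
  by rewrite !fpscoefD.
rewrite /coef_tq; congr (fpscoef _ n).
(* As [m <= K], the coefficient of [t^m] does not see the replacement of each factor by its
   truncation. *)
rewrite -(eqmod_t_prod (fun i => geometric_eqmod_t (w i) (leaK i))) ?leq_addr//.
rewrite bigA_distr_big_dep; congr (fpscoef _ m); apply: eq_big => f.
  by apply/forallP/familyP.
move=> _; rewrite /F.
under [in RHS]eq_bigr do rewrite exprMn -exprM.
rewrite big_split /= !prodrXr; congr (_ ^+ _ * _ ^+ _).
  by apply: eq_bigr => i _; rewrite ffunE.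
by apply: eq_bigr => i _; rewrite ffunE mulnC.
Qed.

Lemma prod_monomial_div (R : comUnitRingType) (J : Type) (s : seq J) (t q : R)
    (a c : J -> nat) (v : J -> R) :
  \prod_(i <- s) ((t * q ^+ c i) ^+ a i / v i) =
  t ^+ (\sum_(i <- s) a i) * q ^+ (\sum_(i <- s) a i * c i) *
    \prod_(i <- s) (v i)^-1.
Proof.
rewrite big_split /=; congr (_ * _); rewrite -!prodrXr -big_split /=.
by apply: eq_bigr => i _; rewrite exprMn -exprM mulnC.
Qed.

(** * Excess of a partition and its corners *)

Section CornerExcess.
Variable d : nat.
Implicit Types (i j : 'rV[nat]_d) (pi mu g : 'rV[nat]_d -> nat).

Local Notation "i .+e l" := (i + delta_mx ord0 l)
  (at level 2, l at level 2, format "i .+e  l").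

Definition height i : nat := (\sum_l i ord0 l)%N.

Definition next_max pi i : nat := (\max_(l < d) pi (i.+e l))%N.

Definition excess pi i : nat := (pi i - next_max pi i)%N.

Lemma incrE i l k : i.+e l ord0 k = (i ord0 k + (k == l))%N.
Proof. by rewrite !mxE eqxx; case: (k == l). Qed.

Lemma height_incr i l : height (i.+e l) = (height i).+1.
Proof.
rewrite /height; under eq_bigr do rewrite incrE.
rewrite big_split /= -[RHS]addn1; congr (_ + _)%N.
by rewrite (bigD1 l) //= eqxx big1 // => k /negPf->.
Qed.

Lemma posvec_incr i l : posvec i -> posvec (i.+e l).
Proof. by move=> pos_i k; rewrite incrE ltn_addr. Qed.

Lemma vle_incr i l : vle i (i.+e l).
Proof. by move=> k; rewrite incrE leq_addr. Qed.

Lemma leq_next_max pi i l : (pi (i.+e l) <= next_max pi i)%N.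
Proof. exact: (leq_bigmax l). Qed.

(** Induction on [B - height i], since each unit step raises the height by one. *)
Lemma downward_ind (B : nat) (P : 'rV[nat]_d -> Prop) :
    (forall i, (B <= height i)%N -> P i) ->
    (forall i, (forall l, P (i.+e l)) -> P i) ->
  forall i, P i.
Proof.
move=> P_high P_step i; have [n] := ubnP (B - height i)%N.
elim: n i => // n IHn i ltn; have [/P_high//|lt_iB] := leqP B (height i).
apply: P_step => l; apply: IHn; rewrite height_incr subnS.
by rewrite prednK ?subn_gt0 // -ltnS.
Qed.

(** A point [i] below [j] and different from it can be raised in some coordinate while staying below
    [j]; such unit steps lead from [i] to [j]. *)
Lemma incr_nonincreasing pi :
    (forall i l, posvec i -> (pi (i.+e l) <= pi i)%N) ->
  forall i j, posvec i -> vle i j -> (pi j <= pi i)%N.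
Proof.
move=> pi_step i j pos_i; elim/(@downward_ind (height j).+1): i pos_i => i.
  move=> lt_ji _ le_ij; suff : (height i <= height j)%N by rewrite leqNgt lt_ji.
  exact: leq_sum.
move=> IHi pos_i le_ij.
have [[l lt_l]|le_ji] := pselect (exists l, i ord0 l < j ord0 l)%N.
  apply: leq_trans (pi_step i l pos_i); apply: IHi; first exact: posvec_incr.
  by move=> k; rewrite incrE; case: eqP => [->|_]; rewrite ?addn1 ?addn0.
suff -> : i = j by [].
apply/rowP => l; apply/eqP; rewrite eqn_leq le_ij leqNgt.
by apply/negP => lt_l; apply: le_ji; exists l.
Qed.

Lemma dpartition_incr pi i l :
  dpartition pi -> posvec i -> (pi (i.+e l) <= pi i)%N.
Proof.
move=> [_ _ pi_dec] pos_i.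
by apply: pi_dec => //; [exact: posvec_incr | exact: vle_incr].
Qed.

Lemma next_max_leq pi i :
  dpartition pi -> posvec i -> (next_max pi i <= pi i)%N.
Proof. by move=> ? ?; apply/bigmax_leqP => l _; exact: dpartition_incr. Qed.

(** The strict lower bound also encodes [1 <= k], including for [d = 0], where the empty maximum is
    0. *)
Lemma CorE pi i k :
  Cor pi (i, k) <-> posvec i /\ (next_max pi i < k <= pi i)%N.
Proof.
split=> [[[/= pos_i /andP[k_gt0 le_k]] notD]|[pos_i /andP[lt_k le_k]]].
  split=> //; rewrite le_k andbT -(prednK k_gt0) ltnS; apply/bigmax_leqP => l _.
  rewrite leqNgt; apply/negP => lt_k; apply: (notD l).
  by split; [exact: posvec_incr | rewrite k_gt0 -(prednK k_gt0)].
split=> [|l [_ /andP[_]]].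
  by split=> //=; rewrite le_k andbT; apply: leq_ltn_trans lt_k.
by apply/negP; rewrite -ltnNge; apply: leq_ltn_trans lt_k; exact: leq_next_max.
Qed.

(** * Corner statistics as sums over the shape *)

Section Shape.
Variable rho : set 'rV[nat]_d.
Hypothesis fin_rho : finite_set rho.
Hypothesis pos_rho : rho `<=` @posvec d.

Local Notation I := (fset_set rho).

Lemma rho_val (x : I) : rho (val x).
Proof. by have := valP x; rewrite in_fset_set // => /set_mem. Qed.

(** By [CorE] the corners above a point form an interval of [excess pi] integers, on which [g] is
    constant. *)
Lemma sum_Cor pi g : dpartition pi -> pshape pi `<=` rho ->
  \sum_(x \in Cor pi) g x.1 = (\sum_(x : I) excess pi (val x) * g (val x))%N.
Proof.
(* [K] bounds [pi] on all of [rho], so the corners can be indexed by a finite type. *)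
move=> part_pi sh_pi; pose K := (\sum_(x : I) pi (val x))%N.
have le_piK (x : I) : (pi (val x) <= K)%N by rewrite /K (bigD1 x) //= leq_addr.
pose h (p : I * 'I_K.+1) : 'rV[nat]_d * nat := (val p.1, p.2 : nat).
pose P (p : I * 'I_K.+1) := (next_max pi (val p.1) < p.2 <= pi (val p.1))%N.
have bij_h : set_bij [set p | P p] (Cor pi) h.
  split=> [p Pp|p p' _ _ [/val_inj eq1 /val_inj eq2]|[i k] /CorE[pos_i lt_k]].
  - by apply/CorE; split=> //; exact/pos_rho/rho_val.
  - by case: p p' eq1 eq2 => [? ?] [? ?] /= -> ->.
  have rho_i : i \in I.
    rewrite in_fset_set //; apply/mem_set/sh_pi; split=> //.
    have /andP[lt1 lt2] := lt_k; apply: leq_trans lt2.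
    exact: leq_ltn_trans lt1.
  have ltkK : (k < K.+1)%N.
    by have /andP[_ le_k] := lt_k; apply: leq_trans (le_piK [` rho_i]%fset).
  by exists ([` rho_i]%fset, Ordinal ltkK).
rewrite (reindex_fsbig h [set p | P p]) // fsbig_finType.
rewrite -(pair_big_dep predT (fun x k => P (x, k)) (fun x k => g (val x))) /=.
apply: eq_bigr => x _.
transitivity
  (\sum_((next_max pi (val x)).+1 <= k < (pi (val x)).+1) g (val x))%N.
  rewrite big_geq_mkord /= (big_ord_widen_cond K.+1
    (fun k => next_max pi (val x) < k)%N (fun=> g (val x))) ?ltnS //.
  exact: le_piK.
by rewrite sum_nat_const_nat subSS.
Qed.

Lemma corE pi : dpartition pi -> pshape pi `<=` rho ->
  cor pi = (\sum_(x : I) excess pi (val x))%N.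
Proof.
move=> part_pi sh_pi; have := sum_Cor (fun=> 1%N) part_pi sh_pi.
rewrite fsbig_finite; last exact: finite_Cor.
under [X in _ = X -> _]eq_bigr do rewrite muln1.
by rewrite /cor card_fset_sum1.
Qed.

(** * Reconstruction of a partition from its excesses *)

Variable B : nat.
Hypothesis height_rho : forall i, rho i -> (height i < B)%N.
Hypothesis rho_incr : forall i l, posvec i -> rho (i.+e l) -> rho i.

(* [percolation mu] is the solution of
   [pi i = mu i + max_l pi (i + e_l)] on the positive vectors. The fuel
   [B - height i] runs out only at heights above [rho], where [pi] vanishes. *)
Fixpoint percolation_rec mu n i : nat :=
  if n is n'.+1
  then (mu i + \max_(l < d) percolation_rec mu n' (i.+e l))%N else 0%N.

Definition percolation mu i : nat :=
  if `[< posvec i >] then percolation_rec mu (B - height i) i else 0%N.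

Section Percolation.
Variable mu : 'rV[nat]_d -> nat.
Hypothesis supp_mu : forall i, ~ rho i -> mu i = 0%N.

Local Notation pi := (percolation mu).

Lemma percolationE i : posvec i -> pi i = (mu i + next_max pi i)%N.
Proof.
move=> pos_i; rewrite /percolation asboolT //.
have nextE : next_max pi i =
    (\max_(l < d) percolation_rec mu (B - (height i).+1) (i.+e l))%N.
  apply: eq_bigr => l _; rewrite /percolation asboolT ?height_incr //.
  exact: posvec_incr.
(* At height [B] or more there is no fuel on either side and [mu i = 0]; below, the recursion spends
   exactly one unit. *)
rewrite nextE subnS; have [le_Bi|lt_iB] := leqP B (height i).
  rewrite (eqP (le_Bi : B - height i == 0)%N) big1 //= addn0 supp_mu //.
  by move/height_rho; rewrite ltnNge le_Bi.
by rewrite -[X in percolation_rec _ X _]prednK ?subn_gt0.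
Qed.

(** Outside a downward closed set every unit step stays outside, so the recursion only ever adds
    zeros. *)
Lemma percolation_supp i : ~ rho i -> pi i = 0%N.
Proof.
elim/(@downward_ind B): i => i.
  by rewrite /percolation -subn_eq0 => /eqP->; case: ifP.
move=> IHi nrho_i; have [pos_i|npos_i] := pselect (posvec i); last first.
  by rewrite /percolation asboolF.
rewrite percolationE // supp_mu // add0n /next_max big1 // => l _.
by apply: IHi => /(rho_incr pos_i).
Qed.

Lemma pshape_percolation : pshape pi `<=` rho.
Proof.
by move=> i [_]; apply: contraPP => /percolation_supp->.
Qed.

Lemma dpartition_percolation : dpartition pi.
Proof.
split=> [i npos_i||i j pos_i _ le_ij].
- by rewrite /percolation asboolF.
- apply: sub_finite_set fin_rho => i /= nz_pi; apply: contrapT => nrho_i.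
  by apply: nz_pi; exact: percolation_supp.
apply: incr_nonincreasing pos_i le_ij => {}i l pos_i.
rewrite [leqRHS]percolationE //; apply: leq_trans (leq_addl _ _).
exact: leq_next_max.
Qed.

Lemma excess_percolation i : posvec i -> excess pi i = mu i.
Proof. by move=> pos_i; rewrite /excess {1}percolationE // addnK. Qed.

End Percolation.

Lemma dpartition_supp pi i :
  dpartition pi -> pshape pi `<=` rho -> ~ rho i -> pi i = 0%N.
Proof.
move=> [pi0 _ _] sh_pi nrho_i; have [pos_i|/pi0//] := pselect (posvec i).
by case: (posnP (pi i)) => // gt0; case: nrho_i; exact: sh_pi.
Qed.

(** Both functions vanish off [rho] and solve the same recursion on it; [next_max_leq] makes the
    truncated subtraction in [excess] exact. *)
Lemma percolation_excess pi mu : dpartition pi -> pshape pi `<=` rho ->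
    (forall i, ~ rho i -> mu i = 0%N) ->
    (forall i, rho i -> mu i = excess pi i) ->
  percolation mu = pi.
Proof.
move=> part_pi sh_pi supp_mu muE.
have off_rho i : ~ rho i -> percolation mu i = pi i.
  by move=> nrho_i; rewrite percolation_supp // (dpartition_supp part_pi).
apply/funext; apply: (@downward_ind B) => i.
  by move=> le_Bi; apply: off_rho => /height_rho; rewrite ltnNge le_Bi.
move=> IHi; have [rho_i|/off_rho//] := pselect (rho i).
have pos_i := pos_rho rho_i; rewrite percolationE // muE //.
suff -> : next_max (percolation mu) i = next_max pi i.
  by rewrite subnK // next_max_leq.
by apply: eq_bigr => l _; exact: IHi.
Qed.

Definition ffun_ext (f : {ffun I -> nat}) i : nat :=
  if insub i is Some x then f x else 0%N.

Lemma ffun_ext_val f (x : I) : ffun_ext f (val x) = f x.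
Proof. by rewrite /ffun_ext valK. Qed.

Lemma ffun_ext_supp f i : ~ rho i -> ffun_ext f i = 0%N.
Proof.
move=> nrho_i; rewrite /ffun_ext insubN // in_fset_set //.
by apply/negP => /set_mem.
Qed.

(** The excesses on [rho] are free parameters. The lower bound [a] lets one bijection serve both
    identities: it is 0 for the first and the indicator of the top corners for the second. *)
Lemma set_bij_percolation (a : 'rV[nat]_d -> nat) :
  set_bij [set f : {ffun I -> nat} | forall x, (a (val x) <= f x)%N]
    [set pi | [/\ dpartition pi, pshape pi `<=` rho &
                  forall i, rho i -> (a i <= excess pi i)%N]]
    (percolation \o ffun_ext).
Proof.
have excessE f x : excess (percolation (ffun_ext f)) (val x) = f x.
  rewrite excess_percolation ?ffun_ext_val //; last exact/pos_rho/rho_val.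
  exact: ffun_ext_supp.
split=> [f le_af|f f' _ _ /= eqff'|pi [part_pi sh_pi le_a]].
- have supp_f := @ffun_ext_supp f; split=> [||i rho_i].
  + exact: dpartition_percolation.
  + exact: pshape_percolation.
  have iI : i \in I by rewrite in_fset_set //; exact: mem_set.
  by rewrite -[i]/(val [` iI]%fset) excessE.
- by apply/ffunP => x; rewrite -!excessE eqff'.
exists [ffun x : I => excess pi (val x)].
  by move=> x; rewrite ffunE; apply: le_a; exact: rho_val.
apply: percolation_excess => // i; first exact: ffun_ext_supp.
move=> rho_i; have iI : i \in I by rewrite in_fset_set //; exact: mem_set.
by rewrite -[i]/(val [` iI]%fset) ffun_ext_val ffunE.
Qed.

Lemma has_sum_excess (a : 'rV[nat]_d -> nat) :
  has_sum_tq
    [set pi | [/\ dpartition pi, pshape pi `<=` rho &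
                  forall i, rho i -> (a i <= excess pi i)%N]]
    (fun pi => ser_t ^+ cor pi * ser_q ^+ ch_weight pi)
    (\big[*%R/1]_(i \in rho)
       ((ser_t * ser_q ^+ ch i) ^+ a i / (1 - ser_t * ser_q ^+ ch i))).
Proof.
rewrite fsbig_finite // big_seq_fsetE /=.
apply: has_sum_tq_bij (set_bij_percolation a) _ _ => [f /= _|]; last first.
  exact: (@has_sum_tq_geometric I (fun x => ch (val x)) (fun x => a (val x))).
set pi := percolation _; have supp_f := @ffun_ext_supp f.
have part_pi : dpartition pi by exact: dpartition_percolation.
have sh_pi : pshape pi `<=` rho by exact: pshape_percolation.
have excessE (x : I) : excess pi (val x) = f x.
  by rewrite excess_percolation ?ffun_ext_val //; exact/pos_rho/rho_val.
have -> : cor pi = (\sum_x f x)%N.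
  by rewrite corE //; apply: eq_bigr => x _; exact: excessE.
have -> : ch_weight pi = (\sum_x f x * ch (val x))%N.
  by rewrite /ch_weight sum_Cor //; apply: eq_bigr => x _; rewrite excessE.
by [].
Qed.

(** At a top corner all upper neighbours have value 0, so the excess there is [pi i] itself.
    Conversely, any other point of [rho] has an upper neighbour in [rho], so positivity descends
    from the top corners to all of [rho]. *)
Lemma pshape_eqP pi : dpartition pi ->
  pshape pi = rho <->
  pshape pi `<=` rho /\ forall i, rho i -> ((i \in Cr rho) <= excess pi i)%N.
Proof.
move=> part_pi; split=> [sh_pi|[sh_pi le_ex]].
  split=> [|i rho_i]; first by rewrite sh_pi.
  case: (boolP (i \in Cr rho)) => // /set_mem[_ top_i].
  rewrite /excess /next_max big1 => [|l _].
    by rewrite subn0; move: rho_i; rewrite -sh_pi => -[].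
  by apply: (dpartition_supp part_pi) (top_i l); rewrite sh_pi.
apply/seteqP; split=> // i rho_i; split; first exact: pos_rho.
elim/(@downward_ind B): i rho_i => i.
  by move=> le_Bi /height_rho; rewrite ltnNge le_Bi.
move=> IHi rho_i; have [top_i|] := pselect (Cr rho i).
  have := le_ex i rho_i; rewrite mem_set // => /leq_trans; apply.
  exact: leq_subr.
move=> ntop_i; have [l rho_il] : exists l, rho (i.+e l).
  apply: contrapT => nex; apply: ntop_i; split=> // l rho_il.
  by apply: nex; exists l.
apply: leq_trans (IHi l rho_il) _; apply: dpartition_incr => //.
exact: pos_rho.
Qed.

Lemma sum_Cr g :
  \sum_(i \in Cr rho) g i = (\sum_(i <- I) (i \in Cr rho) * g i)%N.
Proof.
transitivity (\sum_(i \in Cr rho) ((i \in Cr rho) * g i)%N).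
  by apply: eq_fsbigr => i ->; rewrite mul1n.
rewrite (fsbig_fwiden (I : seq _)) ?fset_uniq //.
  by move=> i [rho_i _] /=; rewrite in_fset_set //; exact: mem_set.
by move=> i [_ ntop_i]; rewrite /= memNset.
Qed.

Lemma crE : cr rho = (\sum_(i <- I) (i \in Cr rho))%N.
Proof.
have := sum_Cr (fun=> 1%N); rewrite fsbig_finite; last exact: finite_Cr.
under [X in _ = X -> _]eq_bigr do rewrite muln1.
by rewrite /cr card_fset_sum1.
Qed.

End Shape.
End CornerExcess.

Theorem theorem5p2 (d : nat) (rho : set 'rV[nat]_d)
    (hrho : exists pi0 : 'rV[nat]_d -> nat,
        dpartition pi0 /\ pshape pi0 = rho) :
  has_sum_tq [set pi : 'rV[nat]_d -> nat | dpartition pi /\ pshape pi `<=` rho]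
    (fun pi => ser_t ^+ cor pi * ser_q ^+ ch_weight pi)
    (\big[*%R/1]_(i \in rho) (1 - ser_t * ser_q ^+ ch i)^-1)
  /\
  has_sum_tq [set pi : 'rV[nat]_d -> nat | dpartition pi /\ pshape pi = rho]
    (fun pi => ser_t ^+ cor pi * ser_q ^+ ch_weight pi)
    (ser_t ^+ cr rho * ser_q ^+ cr_weight rho *
     \big[*%R/1]_(i \in rho) (1 - ser_t * ser_q ^+ ch i)^-1).
Proof.
have [pi0 [part_pi0 sh_pi0]] := hrho.
have fin_rho : finite_set rho by rewrite -sh_pi0; exact: finite_shape.
have pos_rho : rho `<=` @posvec d by rewrite -sh_pi0 => i [].
have rho_incr i l : posvec i -> rho (i + delta_mx ord0 l) -> rho i.
  rewrite -sh_pi0 => pos_i [_ gt0]; split=> //.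
  by apply: leq_trans gt0 _; exact: dpartition_incr.
(* Any strict upper bound for the heights in the finite set [rho] would do. *)
pose B := (\sum_(x : fset_set rho) height (val x)).+1.
have height_rho i : rho i -> (height i < B)%N.
  move=> rho_i; have iI : i \in fset_set rho by rewrite in_fset_set // mem_set.
  by rewrite ltnS (bigD1 [` iI]%fset) //= leq_addr.
have sum_excess := has_sum_excess fin_rho pos_rho height_rho rho_incr.
split.
  have := sum_excess (fun=> 0%N); congr has_sum_tq.
    by apply/seteqP; split=> [pi []|pi []].
  by apply: eq_fsbigr => i _; rewrite expr0 mul1r.
(* With the indicator as lower bound, the numerators multiply to the monomial in [cr rho] and
   [cr_weight rho]. *)
have := sum_excess (fun i => (i \in Cr rho) : nat).
rewrite fsbig_finite; last exact: fin_rho.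
rewrite prod_monomial_div -crE; last exact: fin_rho.
rewrite -sum_Cr; last exact: fin_rho.
rewrite -fsbig_finite; last exact: fin_rho.
congr has_sum_tq; apply/seteqP; split=> pi.
  move=> [part_pi sh_pi le_ex]; split=> //.
  exact/(pshape_eqP pos_rho height_rho).
by move=> [part_pi /(pshape_eqP pos_rho height_rho part_pi)[]].
Qed.
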